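(* Let $X$ be a continuum and let $F\colon X\to 2^X$ be an upper semicontinuous function. If $F(x)$ is connected for every $x\in X$, then $\mathcal{O}_F(x)$ is a continuum for each $x\in X$.
   Context: A continuum is a connected compact metric space. $2^X$ denotes the family of all nonempty closed subsets of $X$. A function $F\colon X\to 2^X$ is upper semicontinuous if for each $x\in X$ and every open subset $V$ of $X$ with $F(x)\subseteq V$, there is an open subset $U$ of $X$ with $x\in U$ and $F(y)\subseteq V$ for all $y\in U$. $\mathbb N=\{1,2,3,\ldots\}$ and $X^{\mathbb N}$ carries the product topology. For $x\in X$, the orbit set of $x$ is $\mathcal{O}_F(x)=\{(x_n)_{n\in\mathbb N}\in X^{\mathbb N} : x_1=x \text{ and } x_{n+1}\in F(x_n) \text{ for each } n\in\mathbb N\}$, regarded as a subspace of $X^{\mathbb N}$. *)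

(* Defs.v *)
From HB Require Import structures.
From mathcomp Require Import all_boot all_order all_algebra.
From mathcomp Require Import all_classical all_reals all_analysis.

Set Implicit Arguments.
Unset Strict Implicit.
Unset Printing Implicit Defensive.

Local Open Scope classical_set_scope.

(* The metric structure [m] carries its own topology, which has to be
   the given one. *)
Definition metrizable (R : realType) (T : topologicalType) : Prop :=
  exists m : Metric R T, @open (Metric.Pack m) = @open T.

(* Nonemptiness is explicit because [connected set0] holds in the library. *)
Definition continuum (R : realType) (T : topologicalType) : Prop :=
  [/\ metrizable R T, [set: T] !=set0, compact [set: T] & connected [set: T]].

Definition hyperspace (X : topologicalType) : set (set X) :=
  [set A | A !=set0 /\ closed A].
Arguments hyperspace : clear implicits.

Definition upper_semicontinuous (X : topologicalType) (F : X -> set X) : Prop :=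
  forall (x : X) (V : set X), open V -> F x `<=` V ->
    exists U : set X, [/\ open U, U x & forall y, U y -> F y `<=` V].

(* Sequences are indexed from 0: [u n] is the term of index n + 1.
   The type [{ptws nat -> X}] carries the product topology. *)
Definition orbit_set (X : topologicalType) (F : X -> set X) (x : X) :
    set {ptws nat -> X} :=
  [set u | u 0%N = x /\ forall n, F (u n) (u n.+1)].

(* Main.v *)
(** Compactness: upper semicontinuity makes the graph of F closed, so the orbit
    set is closed in the compact product.  Connectedness: let B be clopen in the
    orbit set O.  By compactness of B there is an n such that the first n terms
    of an orbit decide whether it lies in B.  If n > 1 then the first n - 1
    terms already decide it: for a fixed prefix ending in y, the possible next
    terms form the connected set F y, and those continued inside B and those
    continued outside B form two disjoint closed sets (images of compact sets)
    covering F y, so one of them is empty.  Descending to n = 1, where all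
    orbits agree, B is empty or equal to O. *)
Require Import Defs.
From HB Require Import structures.
From mathcomp Require Import all_boot all_order all_algebra.
From mathcomp Require Import all_classical all_reals all_analysis.
Set Implicit Arguments.
Unset Strict Implicit.
Unset Printing Implicit Defensive.
Import Order.TTheory GRing.Theory Num.Theory.
Local Open Scope classical_set_scope.
Local Open Scope ring_scope.

(** * Distance functions that induce a given topology *)

(** Keeping the distance an unbundled function on [T] leaves the topology of [T] as the only one in
    play. *)
Record metrizes (R : realType) (T : topologicalType) (d : T -> T -> R) : Prop :=
  { dist0 : forall x, d x x = 0 ;
    dist_eq0 : forall x y, d x y = 0 -> x = y ;
    distC : forall x y, d x y = d y x ;
    distD : forall y x z, d x z <= d x y + d y z ;
    nbhs_dist : forall x A,
      nbhs x A <-> exists2 e, 0 < e & [set y | d x y < e] `<=` A }.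

Lemma dist_ge0 (R : realType) (T : topologicalType) (d : T -> T -> R) x y :
  metrizes d -> 0 <= d x y.
Proof.
move=> dT; rewrite -(@pmulrn_lge0 _ _ 2)// -(dist0 dT x).
by rewrite (le_trans (distD dT y _ _))// (distC dT) -mulr2n.
Qed.

Lemma metric_of_dist (R : realType) (T : choiceType) (d : T -> T -> R) :
  (forall x, d x x = 0) -> (forall x y, d x y = 0 -> x = y) ->
  (forall x y, d x y = d y x) -> (forall y x z, d x z <= d x y + d y z) ->
  exists m : Metric R T, forall x y : Metric.Pack m, mdist x y = d x y.
Proof.
(* HB only finds the choice structure of [T] once it is unpacked. *)
case: T d => T c d d0 deq dC dD.
pose f := isMetric.Build R (Choice.Pack c) d0 deq dC dD.
pose M : metricType R := HB.pack_for (metricType R) T (Choice.Pack c) f.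
by exists (Metric.class M).
Qed.

(** Two topologies coincide as soon as their neighbourhood filters do, and those of a [Metric]
    structure are generated by balls. *)
Lemma metrizableP (R : realType) (T : topologicalType) :
  metrizable R T <-> exists d : T -> T -> R, metrizes d.
Proof.
split=> [[m mT]|[d dT]].
- pose M := Metric.Pack m.
  exists (@mdist R M); split.
  + exact: (@mdistxx R M).
  + exact: (@mdist_positivity R M).
  + exact: (@metric_sym R M).
  + by move=> y x z; exact: (@metric_triangle R M).
  + move=> x A; rewrite -[X in _ <-> X]/(filter_from _ _ A).
    rewrite (@metricType_numDomainType.filter_from_mdist_nbhs R M).
    by rewrite (@nbhsE M) (@nbhsE T) /open_nbhs mT.
- have [m md] := metric_of_dist (dist0 dT) (dist_eq0 dT) (distC dT) (distD dT).
  exists m; pose M := Metric.Pack m.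
  rewrite (@openE T) (@openE M); apply/funext => A; apply/propext.
  suff nbhsM x : @nbhs M M x A <-> @nbhs T T x A.
    by split=> oA x /oA /nbhsM.
  rewrite (nbhs_dist dT) -(@metricType_numDomainType.filter_from_mdist_nbhs R M).
  by split=> -[e e0 eA]; exists e => // y; have := eA y; rewrite /= md.
Qed.

Lemma metrizes_hausdorff (R : realType) (T : topologicalType)
  (d : T -> T -> R) : metrizes d -> hausdorff_space T.
Proof.
move=> dT p q pq; apply: (dist_eq0 dT); apply/eqP/negP => pq0.
have e0 : 0 < d p q / 2.
  by rewrite divr_gt0// lt_neqAle eq_sym (dist_ge0 _ _ dT) andbT; exact/negP.
have nb x : nbhs x [set y | d x y < d p q / 2].
  by apply/(nbhs_dist dT); exists (d p q / 2).
have [z [/= pz qz]] := pq _ _ (nb p) (nb q).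
have := distD dT z p q; rewrite leNgt => /negP; apply.
by rewrite (splitr (d p q)) ltrD// (distC dT).
Qed.

Lemma metrizes_subtype (R : realType) (T : topologicalType) (A : set T)
    (d : T -> T -> R) :
  metrizes d -> metrizes (fun x y : set_type A => d (set_val x) (set_val y)).
Proof.
move=> dT; split.
- by move=> x; exact: (dist0 dT).
- by move=> x y /(dist_eq0 dT); exact: val_inj.
- by move=> x y; exact: (distC dT).
- by move=> y x z; exact: (distD dT).
- move=> x B; split.
  + case=> _ [[C oC <-] /= Cx CB].
    have /(nbhs_dist dT)[e e0 eC] : nbhs (set_val x) C by exact: open_nbhs_nbhs.
    by exists e => // y /eC; exact: CB.
  + case=> e e0 eB; apply: filterS eB _.
    have := @initial_continuous _ _ (set_val : set_type A -> T) x.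
    move=> /(_ [set y | d (set_val x) y < e]); apply.
    by apply/(nbhs_dist dT); exists e.
Qed.

(** * Metrizability of the countable product *)

Section sequence_distance.
Context {R : realType} {X : topologicalType} (d : X -> X -> R).
Hypothesis dX : metrizes d.

(** The cap at 1/(n+1) makes late coordinates negligible, so that the supremum induces the product
    topology and not the uniform one. *)
Let term (u v : nat -> X) n := Num.min (d (u n) (v n)) n.+1%:R^-1.

Definition seq_dist (u v : {ptws nat -> X}) : R := sup (range (term u v)).

Let term_ge0 u v n : 0 <= term u v n.
Proof. by rewrite le_min (dist_ge0 _ _ dX) invr_ge0 ler0n. Qed.

Lemma term_le_seq_dist u v n : term u v n <= seq_dist u v.
Proof.
apply: ub_le_sup; last by exists n.
exists 1 => _ [k _ <-]; rewrite ge_min; apply/orP; right.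
by rewrite invf_le1// ler1n.
Qed.

Lemma seq_dist_le u v c : (forall n, term u v n <= c) -> seq_dist u v <= c.
Proof.
move=> uvc; apply: ge_sup; first by exists (term u v 0); exists 0.
by move=> _ [n _ <-].
Qed.

Lemma seq_distP : metrizes seq_dist.
Proof.
split.
- move=> u; apply/eqP; rewrite eq_le.
  rewrite (le_trans (term_ge0 u u 0)) ?term_le_seq_dist// andbT.
  by apply: seq_dist_le => n; rewrite /term (dist0 dX) ge_min lexx.
- move=> u v uv0; apply/funext => n; apply: (dist_eq0 dX); apply/eqP.
  have := term_le_seq_dist u v n; rewrite uv0 ge_min.
  by rewrite [X in _ || X]leNgt invr_gt0 ltr0Sn orbF eq_le (dist_ge0 _ _ dX) andbT.
- by move=> u v; congr sup; apply: eq_imagel => n _; rewrite /term (distC dX).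
- move=> v u w; apply: seq_dist_le => n.
  apply: le_trans (lerD (term_le_seq_dist u v n) (term_le_seq_dist v w n)).
  have := distD dX (v n) (u n) (w n).
  rewrite /term; set a := d (u n) (w n); set b := d (u n) (v n).
  set c := d (v n) (w n) => abc; rewrite ge_min.
  have b0 : 0 <= b by exact: dist_ge0 dX.
  have c0 : 0 <= c by exact: dist_ge0 dX.
  have i0 : 0 <= n.+1%:R^-1 :> R by rewrite invr_ge0.
  (* If neither summand is capped, [abc] applies; otherwise the cap alone bounds the left side, the
     other summand being nonnegative. *)
  by case: (leP b) => _; case: (leP c) => _;
    rewrite ?abc ?lerDl ?lerDr ?i0 ?b0 ?c0 ?orbT.
- move=> u V; split=> [uV|[e e0 eV]].
  + pose G : set_system {ptws nat -> X} :=
      filter_from [set e : R | 0 < e] (fun e => [set v | seq_dist u v < e]).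
    have GF : Filter G.
      apply: filter_from_filter; first by exists 1; rewrite /= ltr01.
      move=> e f e0 f0; exists (Num.min e f); first by rewrite /= lt_min e0.
      by move=> v /=; rewrite lt_min => /andP[].
    suff Gu : G --> u by exact: Gu V uV.
    apply/cvg_sup => i B [_ [[W oW <-] /= Wu WV]].
    have /(nbhs_dist dX)[e e0 eW] : nbhs (u i) W by exact: open_nbhs_nbhs.
    (* Below 1/(i+1) the cap cannot be the minimum, so the term of index [i] is the distance
       itself. *)
    exists (Num.min e i.+1%:R^-1); first by rewrite /= lt_min e0 invr_gt0 ltr0Sn.
    move=> v /= uve; apply: WV; apply: eW => /=.
    have := le_lt_trans (term_le_seq_dist u v i) uve.
    rewrite /term lt_min !gt_min ltxx orbF => /andP[/orP[//|ie] die].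
    exact: lt_trans ie.
  (* From index [N] on the cap is below e/2, so finitely many coordinates remain to be controlled.
     Halving [e] restores a strict bound after the supremum. *)
  + have e20 : 0 < e / 2 by rewrite divr_gt0.
    have [N _ /(_ _ (leqnn N)) /= Ne] := near_infty_natSinv_lt (PosNum e20).
    have : nbhs u [set v : {ptws nat -> X} | forall i : 'I_N, d (u i) (v i) < e / 2].
      apply: (@filter_forall _ _ (fun (i : 'I_N) (v : {ptws nat -> X}) =>
        d (u i) (v i) < e / 2) (nbhs u) (nbhs_filter u)) => i.
      have := @proj_continuous nat (fun=> X) i u.
      move=> /(_ [set y | d (u i) y < e / 2]); apply.
      by apply/(nbhs_dist dX); exists (e / 2).
    apply: filterS => v uv; apply: eV => /=.
    apply: (@le_lt_trans _ _ (e / 2));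
      last by rewrite ltr_pdivrMr// ltr_pMr// ltr1n.
    apply: seq_dist_le => n; rewrite ge_min.
    have [nN|Nn] := ltnP n N; first by rewrite (ltW (uv (Ordinal nN))).
    rewrite [X in _ || X](le_trans _ (ltW Ne)) ?orbT//.
    by rewrite lef_pV2 ?posrE ?ltr0Sn// ler_nat.
Qed.

End sequence_distance.

(** * Passage from a subset to its subtype *)

Lemma compact_subtype (T : topologicalType) (A : set T) :
  compact A -> compact [set: set_type A].
Proof.
move=> cA G PG _.
have [|p [Ap clp]] := cA (set_val @ G) _.
  by rewrite -[_ A]/(G (set_val @^-1` A)); apply: filterE => y; exact: set_valP.
exists (exist _ p (mem_set Ap)); split => // B Y GB [_ [[W oW <-] /= Wp WY]].
have [||_ [[b Bb <-] Wb]] := clp (set_val @` B) W.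
- suff : G (set_val @^-1` (set_val @` B)) by [].
  by apply: filterS GB => b Bb; exists b.
- exact: open_nbhs_nbhs.
- by exists b; split => //; exact: WY.
Qed.

(** A clopen set of the subtype has a relatively clopen image in [A]. *)
Lemma connected_subtype (T : topologicalType) (A : set T) :
  connected A -> connected [set: set_type A].
Proof.
move=> cA B [b Bb] [C [W oW WC]]; rewrite setTI => BC.
move=> [D]; rewrite -openC => -[V oV VD]; rewrite setTI => BD.
have BA : set_val @` B = A.
  apply: cA; first by exists (set_val b), b.
  - exists W => //; apply/seteqP; split => [_ [c Bc <-]|x [Ax Wx]].
      by split; [exact: set_valP|move: Bc; rewrite BC -WC].
    by exists (exist _ x (mem_set Ax)) => //; rewrite BC -WC.
  - exists (~` V); first exact: open_closedC.
    have BV : B = ~` (set_val @^-1` V) by rewrite VD setCK.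
    apply/seteqP; split => [_ [c Bc <-]|x [Ax Vx]].
      by split; [exact: set_valP|move: Bc; rewrite BV].
    by exists (exist _ x (mem_set Ax)) => //; rewrite BV.
apply/seteqP; split => // a _.
have [c Bc /val_inj <-//] : (set_val @` B) (set_val a).
  by rewrite BA; exact: set_valP.
Qed.

(** * Compactness of the orbit set *)

(** If [b] is not in [F a], regularity gives a neighbourhood [N] of [b] whose closure misses [F a].
    By semicontinuity it misses [F y] for all [y] near [a]. *)
Lemma closed_graph (X : topologicalType) (F : X -> set X) :
  regular_space X -> upper_semicontinuous F -> (forall x, closed (F x)) ->
  closed [set p : X * X | F p.1 p.2].
Proof.
move=> regX uscF clF; rewrite -openC openE => -[a b] /= nFab.
have [N Nb NF] : filter_from (nbhs b) closure (~` F a).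
  by apply: regX; apply: open_nbhs_nbhs; split=> //; exact: closed_openC.
have [||U [oU Ua UN]] := uscF a (~` closure N).
- exact/closed_openC/closed_closure.
- by move=> y Fay /NF.
exists (U, N) => /=; first by split=> //; exact: open_nbhs_nbhs.
by move=> [a' b'] /= [/UN a'N Nb'] /a'N; apply; exact: subset_closure.
Qed.

Lemma closed_orbit_set (X : topologicalType) (F : X -> set X) (x : X) :
  closed [set x] -> closed [set p : X * X | F p.1 p.2] ->
  closed (orbit_set F x).
Proof.
move=> clx clF.
have projC n : continuous (fun u : {ptws nat -> X} => u n).
  exact: (@proj_continuous nat (fun=> X) n).
rewrite (_ : orbit_set F x =
    (fun u : {ptws nat -> X} => u 0%N) @^-1` [set x] `&`
    \bigcap_n (fun u : {ptws nat -> X} => (u n, u n.+1)) @^-1`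
      [set p | F p.1 p.2]).
  apply: closedI; first by apply: preimage_closed.
  apply: closed_bigI => n _; apply: preimage_closed => // u _.
  exact: (cvg_pair (projC n u) (projC n.+1 u)).
by apply/seteqP; split => u [u0 uF]; split => // n; have := uF n; [|apply].
Qed.

Lemma compact_orbit_set (X : topologicalType) (F : X -> set X) (x : X) :
  hausdorff_space X -> compact [set: X] -> upper_semicontinuous F ->
  (forall x, closed (F x)) -> compact (orbit_set F x).
Proof.
move=> hX cX uscF clF.
have cXN := @tychonoff nat (fun=> X) (fun=> setT) (fun=> cX).
apply: (subclosed_compact _ cXN) => //.
apply: closed_orbit_set; first exact/accessible_closed_set1/hausdorff_accessible.
apply: closed_graph => // y.
exact: (compact_regular hX cX filterT).
Qed.

(** * Existence and branching of orbits *)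

Lemma orbit_set_nonempty (X : topologicalType) (F : X -> set X) (x : X) :
  (forall y, F y !=set0) -> orbit_set F x !=set0.
Proof.
move=> /choice[f fF].
by exists (fun n => iter n f x); split => // n; exact: fF.
Qed.

Lemma orbit_set_branch (X : topologicalType) (F : X -> set X) (x y : X) n u :
  (forall z, F z !=set0) -> orbit_set F x u -> F (u n) y ->
  exists v, [/\ orbit_set F x v, forall k, (k <= n)%N -> v k = u k & v n.+1 = y].
Proof.
move=> F0 [u0 uF] uny; have [w [w0 wF]] := orbit_set_nonempty y F0.
(* Follow [u] up to index [n], then an orbit [w] started at [y]. *)
exists (fun k => if (k <= n)%N then u k else w (k - n.+1)%N).
split=> [|k ->//|]; last by rewrite ltnn subnn.
split=> [//|k]; case: (ltngtP k n) => [kn|nk|->].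
- exact: uF.
- by rewrite subSn.
- by rewrite subnn w0.
Qed.

(** * Prefixes and connectedness *)

Definition agree (T : Type) (n : nat) (u v : nat -> T) : Prop :=
  forall k, (k < n)%N -> u k = v k.

Lemma agreeS (T : Type) n (u v : nat -> T) :
  agree n u v -> u n = v n -> agree n.+1 u v.
Proof.
by move=> uv uvn k; rewrite ltnS leq_eqVlt => /predU1P[->//|/uv].
Qed.

Lemma agree_trans (T : Type) n (u v w : nat -> T) :
  agree n u v -> agree n u w -> agree n v w.
Proof. by move=> uv uw k kn; rewrite -uv// uw. Qed.

(** A prefix condition is closed, so the branches are the projection of a compact set to a Hausdorff
    space. *)
Lemma compact_closed_branches (X : topologicalType)
    (K : set {ptws nat -> X}) n u :
  hausdorff_space X -> compact K ->
  closed [set v n | v in K `&` [set v | agree n u v]].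
Proof.
move=> hX cK; apply: compact_closed => //; apply: continuous_compact.
  exact/continuous_subspaceT/(@proj_continuous nat (fun=> X) n).
apply: compact_closedI => //.
have -> : [set v | agree n u v] =
    \bigcap_(k in `I_n) (fun v : {ptws nat -> X} => v k) @^-1` [set u k].
  by apply/seteqP; split => v uv k /uv.
apply: closed_bigI => k _; apply: preimage_closed.
  by move=> v _; exact: (@proj_continuous nat (fun=> X) k).
exact/accessible_closed_set1/hausdorff_accessible.
Qed.

Lemma near_prefix (X : topologicalType) (u : {ptws nat -> X}) C : nbhs u C ->
  \forall v \near u & n \near \oo,
    forall w, agree n v w -> C w.
Proof.
(* The filter [G] collects the sets [C] satisfying the claim; being finer than
   [nbhs u] can be tested one coordinate at a time. *)
pose G : set_system {ptws nat -> X} :=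
  fun V => filter_prod (nbhs u) \oo [set p | agree p.2 p.1 `<=` V].
have GF : Filter G.
  split.
  - exact: (filterS (fun _ _ _ _ => I) filterT).
  - move=> V W; apply: (@filterS2 _ (filter_prod (nbhs u) \oo)).
    by move=> p pV pW w pw; split; [exact: pV|exact: pW].
  - move=> V W VW; apply: (@filterS _ (filter_prod (nbhs u) \oo)).
    by move=> p pV w /pV; exact: VW.
suff Gu : G --> u by exact: Gu.
apply/cvg_sup => i B [_ [[W oW <-] /= Wu WB]].
exists ((fun v : {ptws nat -> X} => v i) @^-1` W, [set n | (i < n)%N]) => /=.
  split; last by exists i.+1.
  by have := @proj_continuous nat (fun=> X) i u; apply; exact: open_nbhs_nbhs.
by move=> [v n] /= [Wv ni] w vw; apply: WB => /=; rewrite -vw.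
Qed.

(** Near each point of [B] some prefix length forces membership in [C]; compactness of [B], in its
    near-covering form, makes one length serve all points. *)
Lemma clopen_prefix (X : topologicalType) (A B C D : set {ptws nat -> X}) :
  compact A -> open C -> closed D -> B = A `&` C -> B = A `&` D ->
  exists n, forall u v, A v -> agree n u v -> B u -> B v.
Proof.
move=> cA oC clD BC BD.
have cB : compact B by rewrite BD; exact: compact_closedI.
have := (compact_near_coveringP B).1 cB nat \oo (fun n u =>
  forall w, agree n u w -> C w) _.
case.
  by move=> u; rewrite BC => -[_ Cu]; apply: near_prefix; exact: open_nbhs_nbhs.
move=> n _ /(_ n (leqnn n)) nB; exists n => u v Av uv Bu.
by rewrite BC; split => //; exact: nB uv.
Qed.

Lemma connected_orbit_set (X : topologicalType) (F : X -> set X) (x : X) :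
  hausdorff_space X -> (forall y, F y !=set0) -> (forall y, connected (F y)) ->
  compact (orbit_set F x) -> connected (orbit_set F x).
Proof.
move=> hX F0 cF cO B [b Bb] [C oC BC] [D clD BD].
set O := orbit_set F x in cO BC BD *.
have BO : B `<=` O by rewrite BC => ? [].
have cB : compact B by rewrite BD; exact: compact_closedI.
have cB' : compact (O `\` B).
  have -> : O `\` B = O `&` ~` C.
    by rewrite BC; apply/seteqP; split => u [Ou nCu]; split => //;
      [by move=> Cu; exact: nCu|by move=> [_ /nCu]].
  by apply: compact_closedI => //; exact: open_closedC.
have shorten n : (forall u v, O v -> agree n.+2 u v -> B u -> B v) ->
    forall u v, O v -> agree n.+1 u v -> B u -> B v.
  move=> dec u v Ov uv Bu; apply: contrapT => nBv.
  (* [S] and [S'] are the possible next terms inside and outside [B]. *)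
  pose S := [set w n.+1 | w in B `&` [set w | agree n.+1 u w]].
  pose S' := [set w n.+1 | w in (O `\` B) `&` [set w | agree n.+1 u w]].
  have SF : S `<=` F (u n).
    by move=> _ [w [/BO[_ wF] /(_ n (leqnn _)) ->] <-].
  have Sv : S (v n.+1).
    suff -> : S = F (u n) by rewrite (uv n)//; case: Ov.
    apply: cF; first by exists (u n.+1), u.
    - exists (~` S'); first exact/closed_openC/compact_closed_branches.
      apply/seteqP; split => y.
      + move=> Sy; split; first exact: SF.
        (* A common next term would give two orbits agreeing on n+2 terms, one in [B] and one not,
           against [dec]. *)
        case: Sy => w [Bw uw] <- [w' [[Ow' nBw'] uw']] ww'.
        apply: nBw'; apply: (dec w) => //; apply: agreeS => //.
        exact: agree_trans uw uw'.
      + move=> [Fy S'y].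
        (* Every point of [F (u n)] continues the prefix to an orbit, which must lie in [B] since
           [y] is not in [S']. *)
        have [w [Ow wu wy]] := orbit_set_branch F0 (BO _ Bu) Fy.
        exists w => //; split; last by move=> k kn; rewrite wu.
        apply: contrapT => nBw; apply: S'y; exists w => //; split => //.
        by move=> k kn; rewrite wu.
    - exists S; first exact: compact_closed_branches.
      by apply/esym/setIidr.
  case: Sv => w [Bw uw] wv; apply: nBv; apply: (dec w) => //.
  by apply: agreeS => //; exact: agree_trans uw uv.
have [n dec] := clopen_prefix cO oC clD BC BD.
have {dec} : forall u v, O v -> agree n.+1 u v -> B u -> B v.
  (* The length found may be 0; raising it by one lets the descent stop at length 1. *)
  by move=> u v Ov uv; apply: dec => // k kn; apply: uv; rewrite ltnS ltnW.
elim: n => [dec|n IH /shorten//].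
(* At length 1 only the common first term [x] is compared. *)
apply/seteqP; split => // v Ov; apply: (dec b) => // -[_|//].
by have [-> _] := BO _ Bb; have [-> _] := Ov.
Qed.

Theorem theorem3p15 (R : realType) (X : topologicalType) (F : X -> set X) :
  continuum R X ->
  (forall x, hyperspace X (F x)) ->
  upper_semicontinuous F ->
  (forall x, connected (F x)) ->
  forall x : X, continuum R (set_type (orbit_set F x)).
Proof.
move=> [/metrizableP[d dX] _ cX _] hF uscF cF x.
have F0 y : F y !=set0 by case: (hF y).
have clF y : closed (F y) by case: (hF y).
have hX := metrizes_hausdorff dX.
have cO : compact (orbit_set F x) by exact: compact_orbit_set.
split.
- by apply/metrizableP; eexists; exact: metrizes_subtype (seq_distP dX).
- have [u Ou] := orbit_set_nonempty x F0.
  by exists (exist _ u (mem_set Ou)).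
- exact: compact_subtype.
- exact/connected_subtype/connected_orbit_set.
Qed.
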